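(* Let $A,B\in\mathbb{R}^{n\times n}$ and let $\lambda_c=i\omega_H$ with $\omega_H>0$ be a critical (purely imaginary) simple characteristic root of the linear delay-differential equation $\dot x(t)=Ax(t)+Bx(t-\tau)$ for $\tau=\tau_H$. Then there is a delay-induced transverse crossing of this characteristic root at $\tau=\tau_H$ if and only if there is a branch $\gamma$ of the asymptotic continuous spectrum with $\gamma(\omega_H)=0$ and $\frac{d}{d\omega}\gamma(\omega_H)\neq 0$. Moreover: - if $\frac{d}{d\omega}\gamma(\omega_H)<0$, then the crossing is destabilizing, with $\frac{d}{d\tau}\operatorname{Re}[\lambda(\tau_H)]>0$; - if $\frac{d}{d\omega}\gamma(\omega_H)>0$, then the crossing is stabilizing, with $\frac{d}{d\tau}\operatorname{Re}[\lambda(\tau_H)]<0$.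
   Context: The DDE is $\dot x(t)=Ax(t)+Bx(t-\tau)$ with real $n\times n$ matrices $A,B$ and time delay $\tau>0$ regarded as a parameter. Its characteristic equation is $\chi(\lambda)=\det[\lambda I-A-Be^{-\lambda\tau}]=0$; solutions $\lambda$ are called characteristic roots. Delay-induced transverse crossing at $\tau=\tau_H$: there is a family of roots $\lambda(\tau)=\alpha(\tau)\pm i\mu(\tau)$ of the characteristic equation with $\alpha(\tau_H)=0$ and $\frac{d\alpha}{d\tau}(\tau_H)\neq0$. It is called stabilizing if $\frac{d\alpha}{d\tau}(\tau_H)<0$ and destabilizing if $\frac{d\alpha}{d\tau}(\tau_H)>0$. In the theorem, $\lambda(\tau)$ is the family with $\lambda(\tau_H)=\lambda_c$. Generating polynomial: $p_\omega(Y)=\det[i\omega I-A-BY]$. Asymptotic continuous spectrum (ACS): the collection of curves $\left\{\frac1\tau\gamma_j(\omega)+i\omega\right\}$, $\omega\in\mathbb{R}$, $j=1,\dots,m$, where $\gamma_j(\omega)=-\ln|Y_j(\omega)|$ and $Y_j(\omega)$ are the roots of the generating polynomial, $p_\omega(Y_j(\omega))=0$. Points $\omega$ for which the polynomial is degenerate, i.e. $p_\omega(Y)\equiv\det[i\omega I-A]$ for all $Y$, are excluded. A branch of the ACS is one of the functions $\gamma=\gamma_j$.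
   Formalization: The branch γ = -ln|Y| is required to carry the critical root, Y(ω_H)=e^{-λ_c τ_H}, with Y differentiable near ω_H; with an arbitrary branch the claim fails when the generating polynomial at ω_H has another root of modulus 1. *)

(* Defs.v *)
From mathcomp Require Import all_boot all_order all_algebra.
From mathcomp Require Export complex.
From mathcomp Require Import all_classical all_reals all_analysis.

Set Implicit Arguments.
Unset Strict Implicit.
Unset Printing Implicit Defensive.

Import Order.TTheory GRing.Theory Num.Theory.
Import numFieldNormedType.Exports.

Local Open Scope classical_set_scope.
Local Open Scope complex_scope.
Local Open Scope ring_scope.

Definition cexp (R : realType) (z : R[i]) : R[i] :=
  (expR (complex.Re z))%:C * (cos (complex.Im z) +i* sin (complex.Im z)).

Definition mxC (R : realType) (n : nat) (A : 'M[R]_n) : 'M[R[i]]_n :=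
  map_mx (real_complex R) A.

Definition char_fun (R : realType) (n : nat) (A B : 'M[R]_n) (tau : R)
    (z : R[i]) : R[i] :=
  \det (z%:M - mxC A - cexp (- (z * tau%:C)) *: mxC B).

(* [R[i]^o] is the complex field normed over itself, so this is the complex
   derivative; it always exists, [char_fun A B tau] being entire. *)
Definition simple_char_root (R : realType) (n : nat) (A B : 'M[R]_n) (tau : R)
    (z : R[i]) : Prop :=
  char_fun A B tau z = 0 /\ derive1 (char_fun A B tau : R[i]^o -> R[i]^o) z != 0.

(* Germ at tau0 of a continuous curve of roots through z0. As A and B are
   real, the conjugate curve then consists of characteristic roots as well. *)
Definition root_family (R : realType) (n : nat) (A B : 'M[R]_n) (tau0 : R)
    (z0 : R[i]) (lam : R -> R[i]) : Prop :=
  lam tau0 = z0 /\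
  \forall t \near tau0,
    char_fun A B t (lam t) = 0 /\ {for t, continuous (lam : R -> R[i]^o)}.

Definition transverse_crossing (R : realType) (n : nat) (A B : 'M[R]_n)
    (tau0 : R) (z0 : R[i]) : Prop :=
  exists lam : R -> R[i],
    [/\ root_family A B tau0 z0 lam,
        complex.Re (lam tau0) = 0,
        derivable (fun t => complex.Re (lam t)) tau0 1
      & derive1 (fun t => complex.Re (lam t)) tau0 != 0].

Definition destabilizing_crossing (R : realType) (n : nat) (A B : 'M[R]_n)
    (tau0 : R) (z0 : R[i]) : Prop :=
  exists lam : R -> R[i],
    [/\ root_family A B tau0 z0 lam,
        complex.Re (lam tau0) = 0,
        derivable (fun t => complex.Re (lam t)) tau0 1
      & 0 < derive1 (fun t => complex.Re (lam t)) tau0].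

Definition stabilizing_crossing (R : realType) (n : nat) (A B : 'M[R]_n)
    (tau0 : R) (z0 : R[i]) : Prop :=
  exists lam : R -> R[i],
    [/\ root_family A B tau0 z0 lam,
        complex.Re (lam tau0) = 0,
        derivable (fun t => complex.Re (lam t)) tau0 1
      & derive1 (fun t => complex.Re (lam t)) tau0 < 0].

Definition gen_poly (R : realType) (n : nat) (A B : 'M[R]_n) (w : R) :
    {poly R[i]} :=
  \det (map_mx polyC ((0 +i* w)%:M - mxC A) - 'X *: map_mx polyC (mxC B)).

Definition degenerate (R : realType) (n : nat) (A B : 'M[R]_n) (w : R) : Prop :=
  gen_poly A B w = (\det ((0 +i* w)%:M - mxC A))%:P.

(* Germ at w0 of the branch gamma = - ln |Y| of the asymptotic continuous
   spectrum carried by a differentiable curve Y of roots of the generating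
   polynomial with Y(w0) = Y0. The value Y0 is recorded because the generating
   polynomial at w0 may have several roots of the same modulus, which gamma(w0)
   alone cannot tell apart. Differentiability is asked of Y, not only of gamma:
   where Y0 is a multiple root, - ln |Y| can be differentiable along a curve of
   roots that is not. *)
Definition acs_branch (R : realType) (n : nat) (A B : 'M[R]_n) (w0 : R)
    (Y0 : R[i]) (gamma : R -> R) : Prop :=
  exists2 Y : R -> R[i], Y w0 = Y0 &
    \forall w \near w0,
      [/\ ~ degenerate A B w,
          root (gen_poly A B w) (Y w),
          derivable (fun s => complex.Re (Y s)) w 1,
          derivable (fun s => complex.Im (Y s)) w 1
        & gamma w = - ln (ComplexField.Normc.normc (Y w))].

(* Main.v *)
(** Strict differentiability of [H (x, y)] at a zero with nonzero [y]-derivative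
    [b] makes the Newton map [y - H (x, y) / b] a contraction, uniformly in [x]
    near the base point; its fixed points form an implicit function with
    derivative [- a / b].  Let [F (z, Y) = det (z I - A - Y B)] and
    [Y0 = exp (- lambdac tauH)].  The characteristic roots solve
    [F (lambda, exp (- lambda tau)) = 0] and the ACS branches solve
    [F (i omega, Y) = 0].  Write [f] for the z-derivative of [F] at
    [(lambdac, Y0)] and [P] for [Y0] times its Y-derivative.  Simplicity of the
    root says [f - tauH P <> 0], and
      [lambda' = lambdac P / (f - tauH P)],  [gamma' = Re (i f / P)],
    whence [Re lambda' |f - tauH P|^2 = - omegaH gamma' |P|^2].  If [P = 0] then
    [lambda' = 0], and no differentiable branch passes through [Y0]: such a
    branch would force [f = 0] as well. *)
Require Import Defs.
From mathcomp Require Import all_boot all_order all_algebra.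
From mathcomp Require Import all_classical all_reals all_analysis.
From mathcomp Require Import perm ring lra.

Set Implicit Arguments.
Unset Strict Implicit.
Unset Printing Implicit Defensive.

Import Order.TTheory GRing.Theory Num.Theory.
Import numFieldNormedType.Exports.

Local Open Scope classical_set_scope.
Local Open Scope complex_scope.
Local Open Scope ring_scope.

Local Notation normc := ComplexField.Normc.normc.
Local Notation normc0 := ComplexField.Normc.normc0.
Local Notation normc1 := ComplexField.Normc.normc1.
Local Notation normcM := ComplexField.Normc.normcM.
Local Notation normcV := ComplexField.Normc.normcV.

(** * Modulus and exponential of complex numbers *)

Section ComplexModulus.
Context {R : realType}.
Implicit Types x y z : R[i].

Lemma normc_ge0 x : 0 <= normc x.
Proof. by case: x => a b; exact: sqrtr_ge0. Qed.

Lemma normc_gt0 x : (0 < normc x) = (x != 0).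
Proof.
rewrite lt_def normc_ge0 andbT; congr negb.
apply/eqP/eqP => [/ComplexField.Normc.eq0_normc//|->].
exact: normc0.
Qed.

Lemma normcD_le x y : normc (x + y) <= normc x + normc y.
Proof. exact: le_normcD. Qed.

Lemma normc_opp x : normc (- x) = normc x.
Proof. exact: normcN. Qed.

Lemma normcB_le x y : normc (x - y) <= normc x + normc y.
Proof. by rewrite -[normc y]normc_opp normcD_le. Qed.

Lemma normc_distC x y : normc (x - y) = normc (y - x).
Proof. by rewrite -normc_opp opprB. Qed.

Lemma normc_real (r : R) : normc r%:C = `|r|.
Proof. by rewrite /= expr0n /= addr0 sqrtr_sqr. Qed.

Lemma norm_Re_le x : `|complex.Re x| <= normc x.
Proof.
by case: x => a b /=; rewrite -sqrtr_sqr ler_wsqrtr// lerDl sqr_ge0.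
Qed.

Lemma norm_Im_le x : `|complex.Im x| <= normc x.
Proof.
by case: x => a b /=; rewrite -sqrtr_sqr ler_wsqrtr// lerDr sqr_ge0.
Qed.

Lemma normc_le_ReIm x : normc x <= `|complex.Re x| + `|complex.Im x|.
Proof.
rewrite {1}[x]complexE.
apply: le_trans (normcD_le _ _) _; rewrite normcM !normc_real.
by rewrite /= expr0n expr1n add0r sqrtr1 mul1r.
Qed.

Lemma norm_normc x : `|x| = (normc x)%:C.
Proof. by rewrite normc_def; case: x. Qed.

Lemma cexpD x y : cexp (x + y) = cexp x * cexp y.
Proof.
case: x => a b; case: y => c d; rewrite /cexp /= expRD cosD sinD.
by apply/eqP; rewrite eq_complex /=; apply/andP; split; apply/eqP; ring.
Qed.

Lemma normc_cexp x : normc (cexp x) = expR (complex.Re x).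
Proof.
rewrite /cexp normcM normc_real ger0_norm ?expR_ge0//=.
by rewrite cos2Dsin2 sqrtr1 mulr1.
Qed.

End ComplexModulus.

(** * Strict differentiability in two complex variables and its chain rule *)

Section StrictDifferentiability.
Context {R : realType}.
Local Notation K := R[i].
Implicit Types (f g h : K -> K -> K) (a b x y : K).

(** Both ends of the increment move near [(x, y)]; this makes the estimate usable at neighbouring
    base points and yields Lipschitz and contraction bounds. Quantifying the radius by [\near 0^'+]
    lets several smallness conditions be met by one filter intersection. *)
Definition sdiff f x y a b :=
  forall e : R, 0 < e -> \forall d \near 0^'+,
    forall x1 y1 x2 y2,
      normc (x1 - x) < d -> normc (y1 - y) < d ->
      normc (x2 - x) < d -> normc (y2 - y) < d ->
    normc (f x1 y1 - f x2 y2 - (a * (x1 - x2) + b * (y1 - y2)))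
      <= e * (normc (x1 - x2) + normc (y1 - y2)).

Lemma sdiff_lip f x y a b : sdiff f x y a b ->
  \forall d \near 0^'+, forall x1 y1 x2 y2,
      normc (x1 - x) < d -> normc (y1 - y) < d ->
      normc (x2 - x) < d -> normc (y2 - y) < d ->
    normc (f x1 y1 - f x2 y2)
      <= (normc a + normc b + 1) * (normc (x1 - x2) + normc (y1 - y2)).
Proof.
move=> /(_ 1 ltr01); apply: filterS => d H x1 y1 x2 y2 h1 h2 h3 h4.
have {H} := H _ _ _ _ h1 h2 h3 h4.
have := normcD_le (f x1 y1 - f x2 y2 - (a * (x1 - x2) + b * (y1 - y2)))
                  (a * (x1 - x2) + b * (y1 - y2)).
rewrite subrK; have := normcD_le (a * (x1 - x2)) (b * (y1 - y2)).
rewrite !normcM.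
have := mulr_ge0 (normc_ge0 a) (normc_ge0 (y1 - y2)).
have := mulr_ge0 (normc_ge0 b) (normc_ge0 (x1 - x2)).
by move: (normc _) (normc _) (normc a) (normc b) (normc (x1 - x2)) => *; lra.
Qed.

(** Allows error terms to be collected up to a fixed factor [C]; the tolerance is rescaled once,
    here. *)
Lemma sdiff_scaled C f x y a b : 0 < C ->
  (forall e : R, 0 < e -> \forall d \near 0^'+,
    forall x1 y1 x2 y2,
      normc (x1 - x) < d -> normc (y1 - y) < d ->
      normc (x2 - x) < d -> normc (y2 - y) < d ->
    normc (f x1 y1 - f x2 y2 - (a * (x1 - x2) + b * (y1 - y2)))
      <= C * e * (normc (x1 - x2) + normc (y1 - y2))) ->
  sdiff f x y a b.
Proof.
move=> C0 H e e0; have := H (C^-1 * e); rewrite mulVKf ?gt_eqF//; apply.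
by rewrite mulr_gt0 ?invr_gt0.
Qed.

(** The error of the composite is the error of [f] at the increments of [g] and [h], plus [a] and
    [b] times the errors of [g] and [h]. The Lipschitz constants [Cg] and [Ch] turn the first into a
    multiple of the increments of [x] and [y]. *)
Lemma sdiff_comp f g h x y a b a1 b1 a2 b2 :
  sdiff f (g x y) (h x y) a b -> sdiff g x y a1 b1 -> sdiff h x y a2 b2 ->
  sdiff (fun x y => f (g x y) (h x y)) x y
    (a * a1 + b * a2) (a * b1 + b * b2).
Proof.
move=> df dg dh.
pose Cg := normc a1 + normc b1 + 1; pose Ch := normc a2 + normc b2 + 1.
have Cg0 : 0 < Cg by rewrite ltr_wpDl// addr_ge0 ?normc_ge0.
have Ch0 : 0 < Ch by rewrite ltr_wpDl// addr_ge0 ?normc_ge0.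
(* The outer error costs [(Cg + Ch) * e], the inner ones [normc a * e] and [normc b * e]. *)
have C0 : 0 < Cg + Ch + normc a + normc b.
  by rewrite ltr_wpDr ?normc_ge0// ltr_wpDr ?normc_ge0// addr_gt0.
apply: (sdiff_scaled C0) => e e0.
have [d' /= d'0 fd'] : exists2 d', 0 < d' & forall x1 y1 x2 y2,
      normc (x1 - g x y) < d' -> normc (y1 - h x y) < d' ->
      normc (x2 - g x y) < d' -> normc (y2 - h x y) < d' ->
    normc (f x1 y1 - f x2 y2 - (a * (x1 - x2) + b * (y1 - y2)))
      <= e * (normc (x1 - x2) + normc (y1 - y2)).
  have [d' [d'0 fd']] := filter_ex (filterI (nbhs_right_gt 0) (df _ e0)).
  by exists d'.
near=> d => x1 y1 x2 y2 h1 h2 h3 h4.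
have d0 : 0 < d by near: d; exact: nbhs_right_gt.
have gl u1 v1 u2 v2 : normc (u1 - x) < d -> normc (v1 - y) < d ->
    normc (u2 - x) < d -> normc (v2 - y) < d ->
    normc (g u1 v1 - g u2 v2) <= Cg * (normc (u1 - u2) + normc (v1 - v2)).
  by move: u1 v1 u2 v2; near: d; exact: sdiff_lip dg.
have hl u1 v1 u2 v2 : normc (u1 - x) < d -> normc (v1 - y) < d ->
    normc (u2 - x) < d -> normc (v2 - y) < d ->
    normc (h u1 v1 - h u2 v2) <= Ch * (normc (u1 - u2) + normc (v1 - v2)).
  by move: u1 v1 u2 v2; near: d; exact: sdiff_lip dh.
(* [g] and [h] have to send the [d]-ball into the [d']-ball where the estimate for [f] holds;
   [2 * d] bounds the sum of the two increments. *)
have dd' : (Cg + Ch) * (2 * d) < d'.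
  rewrite mulrA -ltr_pdivlMl; last by lra.
  by near: d; apply: nbhs_right_lt; rewrite mulr_gt0 ?invr_gt0 //; lra.
have gx u v : normc (u - x) < d -> normc (v - y) < d ->
    normc (g u v - g x y) < d'.
  move=> ud vd; apply: le_lt_trans (gl _ _ _ _ ud vd _ _) _;
    rewrite ?subrr ?normc0//.
  apply: le_lt_trans dd'; apply: ler_pM => //;
    rewrite ?addr_ge0 ?normc_ge0 ?lerDl ?ltW//; lra.
have hx u v : normc (u - x) < d -> normc (v - y) < d ->
    normc (h u v - h x y) < d'.
  move=> ud vd; apply: le_lt_trans (hl _ _ _ _ ud vd _ _) _;
    rewrite ?subrr ?normc0//.
  apply: le_lt_trans dd'; apply: ler_pM => //;
    rewrite ?addr_ge0 ?normc_ge0 ?lerDr ?ltW//; lra.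
have Hf := fd' _ _ _ _ (gx _ _ h1 h2) (hx _ _ h1 h2)
                       (gx _ _ h3 h4) (hx _ _ h3 h4).
have Hg : normc (g x1 y1 - g x2 y2 - (a1 * (x1 - x2) + b1 * (y1 - y2)))
      <= e * (normc (x1 - x2) + normc (y1 - y2)).
  by move: x1 y1 x2 y2 h1 h2 h3 h4 {Hf}; near: d; exact: dg.
have Hh : normc (h x1 y1 - h x2 y2 - (a2 * (x1 - x2) + b2 * (y1 - y2)))
      <= e * (normc (x1 - x2) + normc (y1 - y2)).
  by move: x1 y1 x2 y2 h1 h2 h3 h4 {Hf Hg}; near: d; exact: dh.
have Lg := gl _ _ _ _ h1 h2 h3 h4; have Lh := hl _ _ _ _ h1 h2 h3 h4.
set dx := x1 - x2 in Hg Hh Lg Lh *; set dy := y1 - y2 in Hg Hh Lg Lh *.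
set dG := g x1 y1 - g x2 y2 in Hf Hg Lg *.
set dH := h x1 y1 - h x2 y2 in Hf Hh Lh *.
set dF := f _ _ - f _ _ in Hf *.
have -> : dF - ((a * a1 + b * a2) * dx + (a * b1 + b * b2) * dy) =
  (dF - (a * dG + b * dH)) + (a * (dG - (a1 * dx + b1 * dy)) +
     b * (dH - (a2 * dx + b2 * dy))) by ring.
apply: le_trans (normcD_le _ _) _.
apply: le_trans (lerD Hf (normcD_le _ _)) _; rewrite !normcM.
have := ler_wpM2l (normc_ge0 a) Hg; have := ler_wpM2l (normc_ge0 b) Hh.
have := ler_wpM2l (ltW e0) (lerD Lg Lh).
set N := normc dx + normc dy.
nra.
Unshelve. all: by end_near. Qed.
End StrictDifferentiability.

(** * Calculus of strict derivatives: products, exponential, determinant *)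

Section StrictDifferentiabilityCalculus.
Context {R : realType}.
Local Notation K := R[i].
Implicit Types (f g h : K -> K -> K) (a b x y : K).

(** Without a quotient the point [s = t] satisfies the estimate trivially, so the punctured
    neighbourhood of the limit becomes a full one. *)
Lemma is_derive1P (f : R -> R) (t l : R) : is_derive t 1 f l <->
  forall e : R, 0 < e ->
    \forall s \near t, `|f s - f t - l * (s - t)| <= e * `|s - t|.
Proof.
have E e : (\forall s \near t, `|f s - f t - l * (s - t)| <= e * `|s - t|) <->
    \forall h \near 0^', `|l - h^-1 *: ((f \o shift t) (h *: 1) - f t)| <= e.
  rewrite nbhs0P near_withinE.
  have EQ (h : R) : h != 0 ->
     (`|f (t + h) - f t - l * (t + h - t)| <= e * `|t + h - t|)
     = (`|l - h^-1 *: ((f \o shift t) (h *: 1) - f t)| <= e).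
    move=> h0; rewrite [t + h - t]addrAC subrr add0r.
    rewrite -ler_pdivrMr ?normr_gt0// -normfV -normrM distrC /=.
    rewrite [h *: 1]mulr1 [h + t]addrC [_ *: _]mulrC.
    by congr (`| _ | <= _); field.
  split; apply: filterS => h; first by move=> H h0; rewrite -EQ.
  have [-> _|h0 /(_ isT)] := eqVneq h 0; last by rewrite EQ.
  by rewrite addr0 !subrr mulr0 subr0 normr0 mulr0.
split.
  move=> [df dl] e e0; apply/E; rewrite -dl.
  by move/cvgrPdist_le : df; exact.
move=> H; suff L : h^-1 *: ((f \o shift t) (h *: 1) - f t) @[h --> 0^'] --> l.
  by apply: DeriveDef; [apply/cvg_ex; exists l | apply: cvg_lim].
by apply/cvgrPdist_le => e e0; apply/E; exact: H.
Qed.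

Lemma sdiff_cst c x y : sdiff (fun _ _ => c) x y 0 0.
Proof.
move=> e e0; apply: nearW => d x1 y1 x2 y2 _ _ _ _.
rewrite subrr !mul0r addr0 subrr normc0.
by rewrite mulr_ge0 ?addr_ge0 ?normc_ge0 ?ltW.
Qed.

Lemma sdiff_fst x y : sdiff (fun x _ => x) x y 1 0.
Proof.
move=> e e0; apply: nearW => d x1 y1 x2 y2 _ _ _ _.
rewrite mul0r mul1r addr0 subrr normc0.
by rewrite mulr_ge0 ?addr_ge0 ?normc_ge0 ?ltW.
Qed.

Lemma sdiff_snd x y : sdiff (fun _ y => y) x y 0 1.
Proof.
move=> e e0; apply: nearW => d x1 y1 x2 y2 _ _ _ _.
rewrite mul0r mul1r add0r subrr normc0.
by rewrite mulr_ge0 ?addr_ge0 ?normc_ge0 ?ltW.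
Qed.

Lemma sdiff_add x y : sdiff (fun x y => x + y) x y 1 1.
Proof.
move=> e e0; apply: nearW => d x1 y1 x2 y2 _ _ _ _.
rewrite !mul1r addrACA -opprD subrr normc0.
by rewrite mulr_ge0 ?addr_ge0 ?normc_ge0 ?ltW.
Qed.

Lemma sdiff_mul x y : sdiff (fun x y => x * y) x y y x.
Proof.
move=> e e0; near=> d => x1 y1 x2 y2 h1 h2 h3 h4.
have -> : x1 * y1 - x2 * y2 - (y * (x1 - x2) + x * (y1 - y2)) =
  (x1 - x2) * (y1 - y) + (x2 - x) * (y1 - y2) by ring.
have de : d <= e by near: d; exact: nbhs_right_le.
apply: le_trans (normcD_le _ _) _; rewrite !normcM mulrDr [e * _]mulrC.
by apply: lerD; [apply: ler_wpM2l | apply: ler_wpM2r];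
  rewrite ?normc_ge0// (le_trans _ de)// ltW.
Unshelve. all: by end_near. Qed.

Lemma sdiff_eq f x y a b a' b' :
  sdiff f x y a b -> a = a' -> b = b' -> sdiff f x y a' b'.
Proof. by move=> + <- <-. Qed.

(** The expansion at the origin is assembled from the real derivatives of [expR], [cos] and [sin] at
    0. *)
Lemma cexp_sub1_small (e : R) : 0 < e -> \forall d \near 0^'+,
  forall h : K, normc h < d -> normc (cexp h - 1 - h) <= e * normc h.
Proof.
move=> e0.
(* The four error terms below are at most 1, 2, 2 and 1 times [e1 * N], whence the 6; the cap at 1
   keeps [1 + s] bounded by 2. *)
pose e1 := Num.min 1 (e / 6); have e10 : 0 < e1 by rewrite lt_min; lra.
have ball0 (P : R -> Prop) : (\forall s \near 0, P s) ->
    \forall d \near 0^'+, forall s, `|s| < d -> P s.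
  move=> /nbhs_ballP[d /= d0 dP]; near=> d1 => s sd1; apply: dP.
  rewrite /ball/= sub0r normrN (lt_le_trans sd1)//.
  by near: d1; exact: nbhs_right_le.
have Dexp : \forall d \near 0^'+, forall s : R, `|s| < d ->
    `|expR s - 1 - s| <= e1 * `|s|.
  have := ball0 _ ((is_derive1P _ _ _).1 (is_derive_expR 0) _ e10).
  by apply: filterS => d H s /H; rewrite expR0 mul1r !subr0.
have Dcos : \forall d \near 0^'+, forall s : R, `|s| < d ->
    `|cos s - 1| <= e1 * `|s|.
  have := ball0 _ ((is_derive1P _ _ _).1 (is_derive_cos 0) _ e10).
  by apply: filterS => d H s /H; rewrite cos0 sin0 oppr0 mul0r subr0 !addr0.
have Dsin : \forall d \near 0^'+, forall s : R, `|s| < d ->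
    `|sin s - s| <= e1 * `|s|.
  have := ball0 _ ((is_derive1P _ _ _).1 (is_derive_sin 0) _ e10).
  by apply: filterS => d H s /H; rewrite sin0 cos0 mul1r !subr0.
have e11 : e1 <= 1 by rewrite ge_min lexx.
have e16 : 6 * e1 <= e.
  by rewrite mulrC -ler_pdivlMr// ge_min lexx orbT.
have e12 : 0 < e1 / 2 by lra.
near=> d; have de : d <= e1 / 2 by near: d; exact: nbhs_right_le.
have Hexp (s : R) : `|s| < d -> `|expR s - 1 - s| <= e1 * `|s|.
  by move: s; near: d.
have Hcos (s : R) : `|s| < d -> `|cos s - 1| <= e1 * `|s|.
  by move: s; near: d.
have Hsin (s : R) : `|s| < d -> `|sin s - s| <= e1 * `|s|.
  by move: s; near: d.
move=> [s t]; set N := normc (s +i* t) => Nd.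
have sN : `|s| <= N by exact: (norm_Re_le (s +i* t)).
have tN : `|t| <= N by exact: (norm_Im_le (s +i* t)).
have He := Hexp _ (le_lt_trans sN Nd).
have Hc := Hcos _ (le_lt_trans tN Nd).
have Hs := Hsin _ (le_lt_trans tN Nd).
have s0 : 0 <= `|s| := normr_ge0 s; have t0 : 0 <= `|t| := normr_ge0 t.
have He1 : `|expR s - 1| <= e1.
  have -> : expR s - 1 = (expR s - 1 - s) + s by ring.
  by rewrite (le_trans (ler_normD _ _))//; nra.
have Hs1 : `|sin t| <= 2 * N.
  have -> : sin t = (sin t - t) + t by ring.
  by rewrite (le_trans (ler_normD _ _))//; nra.
have -> : cexp (s +i* t) - 1 - (s +i* t) =
  ((expR s - 1 - s) * cos t + (1 + s) * (cos t - 1)) +i*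
  ((expR s - 1) * sin t + (sin t - t)).
  by apply/eqP; rewrite eq_complex /=; apply/andP; split; apply/eqP; ring.
rewrite (le_trans (normc_le_ReIm _))//=.
have cos1 : `|cos t| <= 1 by rewrite ler_norml cos_geN1 cos_le1.
have H1 : `|(expR s - 1 - s) * cos t| <= e1 * N.
  rewrite normrM; have := ler_wpM2l (normr_ge0 (expR s - 1 - s)) cos1.
  nra.
have H2 : `|(1 + s) * (cos t - 1)| <= 2 * (e1 * N).
  rewrite normrM; apply: ler_pM => //.
    by rewrite (le_trans (ler_normD _ _))// normr1; lra.
  by nra.
have H3 : `|(expR s - 1) * sin t| <= e1 * (2 * N) by rewrite normrM ler_pM.
apply: le_trans (lerD (ler_normD _ _) (ler_normD _ _)) _.
nra.
Unshelve. all: by end_near. Qed.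

(** The functional equation carries the expansion at 0 to any base point: [cexp x1 - cexp x2] is
    [cexp x * cexp (x2 - x)] times [cexp (x1 - x2) - 1], and [cexp (x2 - x)] is close to 1. *)
Lemma sdiff_cexp x y : sdiff (fun x _ => cexp x) x y (cexp x) 0.
Proof.
(* The 3 is the 2 of [F3] plus the 1 of [F2]; the [+ 1] makes positivity immediate. *)
have C0 : 0 < 3 * normc (cexp x) + 1 by rewrite ltr_wpDl// mulr_ge0 ?normc_ge0.
apply: (sdiff_scaled C0) => e e0.
pose e1 := Num.min 1 e; have e10 : 0 < e1 by rewrite lt_min ltr01.
have e11 : e1 <= 1 by rewrite ge_min lexx.
have e1e : e1 <= e by rewrite ge_min lexx orbT.
have e12 : 0 < e1 / 2 by lra.
have [d' [d'0 Hd']] := filter_ex (filterI (nbhs_right_gt 0)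
   (cexp_sub1_small e10)).
have d'2 : 0 < d' / 2 by lra.
near=> d => x1 y1 x2 y2 h1 _ h2 _.
have dd' : d <= d' / 2 by near: d; exact: nbhs_right_le.
have de : d <= e1 / 2 by near: d; exact: nbhs_right_le.
have h12 : normc (x1 - x2) < d'.
  have -> : x1 - x2 = (x1 - x) - (x2 - x) by ring.
  by rewrite (le_lt_trans (normcB_le _ _))//; lra.
have F2 : normc (cexp (x2 - x) - 1) <= e1.
  have -> : cexp (x2 - x) - 1 = (cexp (x2 - x) - 1 - (x2 - x)) + (x2 - x).
    by ring.
  rewrite (le_trans (normcD_le _ _))//.
  have := Hd' (x2 - x) ltac:(lra).
  by nra.
have F3 : normc (cexp (x2 - x)) <= 2.
  have -> : cexp (x2 - x) = (cexp (x2 - x) - 1) + 1 by ring.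
  by rewrite (le_trans (normcD_le _ _))// normc1; lra.
have E2 : cexp x2 = cexp x * cexp (x2 - x) by rewrite -cexpD addrC subrK.
have E1 : cexp x1 = cexp x2 * cexp (x1 - x2) by rewrite -cexpD addrC subrK.
have -> : cexp x1 - cexp x2 - (cexp x * (x1 - x2) + 0 * (y1 - y2)) =
  cexp x * (cexp (x2 - x) * (cexp (x1 - x2) - 1 - (x1 - x2)) +
    (cexp (x2 - x) - 1) * (x1 - x2)) by rewrite E1 E2; ring.
rewrite normcM.
have F1 := Hd' _ h12.
have F : normc (cexp (x2 - x) * (cexp (x1 - x2) - 1 - (x1 - x2)) +
    (cexp (x2 - x) - 1) * (x1 - x2)) <= 3 * e * normc (x1 - x2).
  rewrite (le_trans (normcD_le _ _))// (normcM (cexp _)) (normcM (_ - 1)).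
  have := ler_pM (normc_ge0 _) (normc_ge0 _) F3 F1.
  have := ler_wpM2r (normc_ge0 (x1 - x2)) F2.
  have := ler_wpM2r (normc_ge0 (x1 - x2)) e1e.
  by lra.
have := ler_wpM2l (normc_ge0 (cexp x)) F.
have := mulr_ge0 (ltW C0) (mulr_ge0 (ltW e0) (normc_ge0 (y1 - y2))).
have := mulr_ge0 (ltW e0) (normc_ge0 (x1 - x2)).
by lra.
Unshelve. all: by end_near. Qed.

(** The partial derivatives stay existential: the argument uses only relations between them, so
    those of a determinant are never computed. *)
Definition sdiffable f x y := exists a b, sdiff f x y a b.

Lemma sdiffableD f g x y : sdiffable f x y -> sdiffable g x y ->
  sdiffable (fun x y => f x y + g x y) x y.
Proof.
move=> [a1 [b1 df]] [a2 [b2 dg]]; do 2!eexists.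
exact: sdiff_comp (sdiff_add _ _) df dg.
Qed.

Lemma sdiffableM f g x y : sdiffable f x y -> sdiffable g x y ->
  sdiffable (fun x y => f x y * g x y) x y.
Proof.
move=> [a1 [b1 df]] [a2 [b2 dg]]; do 2!eexists.
exact: sdiff_comp (sdiff_mul _ _) df dg.
Qed.

Lemma sdiffable_cst c x y : sdiffable (fun _ _ => c) x y.
Proof. by do 2!eexists; exact: sdiff_cst. Qed.

Lemma sdiffable_ext f g x y : (forall x y, f x y = g x y) ->
  sdiffable f x y -> sdiffable g x y.
Proof.
by move=> fg; have -> : f = g by apply/funext => ?; apply/funext => ?.
Qed.

Lemma sdiffable_sum (I : Type) (r : seq I) (F : I -> K -> K -> K) x y :
  (forall i, sdiffable (F i) x y) ->
  sdiffable (fun x y => \sum_(i <- r) F i x y) x y.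
Proof.
move=> dF; elim: r => [|i r IH].
  by apply: sdiffable_ext (sdiffable_cst 0 x y) => u v; rewrite big_nil.
by apply: sdiffable_ext (sdiffableD (dF i) IH) => u v; rewrite big_cons.
Qed.

Lemma sdiffable_prod (I : Type) (r : seq I) (F : I -> K -> K -> K) x y :
  (forall i, sdiffable (F i) x y) ->
  sdiffable (fun x y => \prod_(i <- r) F i x y) x y.
Proof.
move=> dF; elim: r => [|i r IH].
  by apply: sdiffable_ext (sdiffable_cst 1 x y) => u v; rewrite big_nil.
by apply: sdiffable_ext (sdiffableM (dF i) IH) => u v; rewrite big_cons.
Qed.

(** [\det] is its Leibniz sum of products of entries, and each entry is affine in [x] and [y]. *)
Lemma sdiffable_det n (A B : 'M[K]_n) x y :
  sdiffable (fun x y => \det (x%:M - A - y *: B)) x y.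
Proof.
apply: sdiffable_sum => s; apply: sdiffableM; first exact: sdiffable_cst.
apply: sdiffable_prod => i.
suff : sdiffable (fun x y => (i == s i)%:R * x + (- A i (s i)) +
    y * (- B i (s i))) x y.
  by apply: sdiffable_ext => u v; rewrite !mxE mulrN mulr_natl.
apply: sdiffableD; first apply: sdiffableD; try exact: sdiffable_cst.
  apply: sdiffableM; first exact: sdiffable_cst.
  by do 2!eexists; exact: sdiff_fst.
apply: sdiffableM; last exact: sdiffable_cst.
by do 2!eexists; exact: sdiff_snd.
Qed.

End StrictDifferentiabilityCalculus.

(** * Solving an equation in the second variable by Newton iteration *)

Section NewtonIteration.
Context {R : realType}.
Local Notation K := R[i].
Implicit Types (H : K -> K -> K) (a b x y : K).

(** With tolerance [normc b / 2], the strict estimate between two zeros leaves half of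
    [normc b * normc (y1 - y2)] on the left, which gives the constant. The case [x1 = x2] is local
    uniqueness of the zero. *)
Lemma sdiff_implicit_lip H x y a b : sdiff H x y a b -> b != 0 ->
  \forall d \near 0^'+, forall x1 y1 x2 y2,
    normc (x1 - x) < d -> normc (y1 - y) < d ->
    normc (x2 - x) < d -> normc (y2 - y) < d ->
    H x1 y1 = 0 -> H x2 y2 = 0 ->
    normc (y1 - y2) <= (2 * normc a + normc b) / normc b * normc (x1 - x2).
Proof.
move=> dH; rewrite -normc_gt0 => b0.
have b20 : 0 < normc b / 2 by lra.
apply: filterS (dH _ b20) => d Hd x1 y1 x2 y2 h1 h2 h3 h4 E1 E2.
have := Hd _ _ _ _ h1 h2 h3 h4; rewrite E1 E2 subrr sub0r normc_opp.
have := normcB_le (a * (x1 - x2) + b * (y1 - y2)) (a * (x1 - x2)).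
rewrite addrAC subrr add0r (normcM a) (normcM b).
move=> H1 H2; rewrite mulrAC ler_pdivlMr//.
by lra.
Qed.

Lemma geometric_cvg (v : nat -> R) (M : R) :
  (forall k, `|v k.+1 - v k| <= M * (2^-1) ^+ k) -> cvgn v.
Proof.
move=> vM; have : cvgn (series (telescope v)).
  apply: normed_cvg.
  apply: series_le_cvg (is_cvg_geometric_series _) => [n|n|n|].
  - exact: normr_ge0.
  - by rewrite /geometric /=; apply: le_trans (vM n); exact: normr_ge0.
  - exact: vM.
  - by rewrite ger0_norm ?invr_ge0//; lra.
rewrite telescopeK => vc.
have -> : v = (fun n => v n - v 0%N) \+ cst (v 0%N).
  by apply/funext => n /=; rewrite subrK.
by apply: is_cvgD => //; exact: is_cvg_cst.
Qed.

(** Completeness is used coordinatewise: the increments of the real and imaginary parts are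
    dominated by the modulus. *)
Lemma complex_geometric_cvg (u : nat -> K) (M : R) :
  (forall k, normc (u k.+1 - u k) <= M * (2^-1) ^+ k) ->
  exists l, forall e : R, 0 < e -> \forall k \near \oo, normc (u k - l) < e.
Proof.
move=> uM.
have /cvg_ex[/= p up] : cvgn (fun k => complex.Re (u k)).
  apply: (geometric_cvg (M := M)) => k; rewrite -raddfB.
  exact: le_trans (norm_Re_le _) (uM k).
have /cvg_ex[/= q uq] : cvgn (fun k => complex.Im (u k)).
  apply: (geometric_cvg (M := M)) => k; rewrite -raddfB.
  exact: le_trans (norm_Im_le _) (uM k).
exists (p +i* q) => e e0; have e20 : 0 < e / 2 by lra.
near=> k; apply: le_lt_trans (normc_le_ReIm _) _.
have -> : complex.Re (u k - (p +i* q)) = complex.Re (u k) - p.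
  by case: (u k).
have -> : complex.Im (u k - (p +i* q)) = complex.Im (u k) - q.
  by case: (u k).
rewrite [ltRHS](splitr e) ltrD// distrC; near: k.
  by move/cvgrPdist_lt : up; exact.
by move/cvgrPdist_lt : uq; exact.
Unshelve. all: by end_near. Qed.

(** The Newton map [T] keeps the slope [b] of the base point, and the strict estimate with tolerance
    [normc b / 2] makes it halve distances on the [d]-ball for every [x] close to [x0]. The zero is
    the limit of the iterates of [y0]. *)
Lemma sdiff_solvable H x0 y0 a b : sdiff H x0 y0 a b -> b != 0 ->
  H x0 y0 = 0 ->
  \forall d \near 0^'+, \forall r \near 0^'+,
    forall x, normc (x - x0) < r -> exists2 y, normc (y - y0) < d & H x y = 0.
Proof.
move=> dH; rewrite -normc_gt0 => b0 H0.
have b20 : 0 < normc b / 2 by lra.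
pose L := normc a + normc b + 1.
have L0 : 0 < L by rewrite ltr_wpDl// addr_ge0 ?normc_ge0.
near=> d; near=> r => x xr.
have d0 : 0 < d by near: d; exact: nbhs_right_gt.
have xd : normc (x - x0) < d.
  by apply: lt_le_trans xr _; near: r; exact: nbhs_right_le.
(* This makes the first Newton step at most [d / 4]. Steps halve, so the iterates stay within
   [d / 2] of [y0] and the limit falls in the open [d]-ball. *)
have xLd : L * normc (x - x0) <= normc b * (d / 4).
  rewrite -ler_pdivlMl//; apply/ltW; apply: lt_le_trans xr _; near: r.
  by apply: nbhs_right_le; rewrite !mulr_gt0// ?invr_gt0//; lra.
have lipH y1 y2 : normc (y1 - y0) < d -> normc (y2 - y0) < d ->
    normc (H x y1 - H x y2) <= L * normc (y1 - y2).
  have /(_ x y1 x y2) : forall x1 y1 x2 y2,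
      normc (x1 - x0) < d -> normc (y1 - y0) < d ->
      normc (x2 - x0) < d -> normc (y2 - y0) < d ->
    normc (H x1 y1 - H x2 y2) <= L * (normc (x1 - x2) + normc (y1 - y2)).
    by near: d; exact: sdiff_lip dH.
  by rewrite subrr normc0 add0r => H1 ? ?; exact: H1.
pose T y := y - H x y / b.
have cT y1 y2 : normc (y1 - y0) < d -> normc (y2 - y0) < d ->
    normc (T y1 - T y2) <= 2^-1 * normc (y1 - y2).
  have /(_ x y1 x y2) : forall x1 y1 x2 y2,
      normc (x1 - x0) < d -> normc (y1 - y0) < d ->
      normc (x2 - x0) < d -> normc (y2 - y0) < d ->
      normc (H x1 y1 - H x2 y2 - (a * (x1 - x2) + b * (y1 - y2))) <=
      normc b / 2 * (normc (x1 - x2) + normc (y1 - y2)).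
    by near: d; exact: dH.
  rewrite subrr normc0 mulr0 !add0r => H1 h1 h2.
  have {H1} := H1 xd h1 xd h2.
  have -> : H x y1 - H x y2 - b * (y1 - y2) = - (b * (T y1 - T y2)).
    by rewrite /T; field; rewrite -normc_gt0.
  by rewrite normc_opp normcM -mulrA ler_pM2l.
pose u k := iter k T y0.
have Hxy0 : normc (H x y0) <= L * normc (x - x0).
  have /(_ x y0 x0 y0) : forall x1 y1 x2 y2,
      normc (x1 - x0) < d -> normc (y1 - y0) < d ->
      normc (x2 - x0) < d -> normc (y2 - y0) < d ->
    normc (H x1 y1 - H x2 y2) <= L * (normc (x1 - x2) + normc (y1 - y2)).
    by near: d; exact: sdiff_lip dH.
  by rewrite H0 !subrr subr0 normc0 addr0; exact.
(* Both bounds go through one induction, since the contraction applies only to iterates known to lie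
   in the ball. *)
have u_inv k : normc (u k - y0) <= (1 - (2^-1) ^+ k) * (d / 2) /\
    normc (u k.+1 - u k) <= d / 4 * (2^-1) ^+ k.
  elim: k => [|k [IH1 IH2]].
    rewrite expr0 [1 - 1]subrr mul0r mulr1; change (u 0%N) with y0.
    rewrite subrr normc0; split => //.
    change (u 1%N) with (T y0); rewrite /T addrAC subrr add0r normc_opp normcM.
    rewrite normcV ler_pdivrMr// mulrC.
    exact: le_trans Hxy0 xLd.
  have q0 : 0 < (2^-1 : R) ^+ k by rewrite exprn_gt0// invr_gt0.
  have IH3 : normc (u k.+1 - y0) <= (1 - (2^-1) ^+ k.+1) * (d / 2).
    have -> : u k.+1 - y0 = (u k.+1 - u k) + (u k - y0) by ring.
    apply: le_trans (normcD_le _ _) _; rewrite exprS; nra.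
  split => //; rewrite exprS.
  have q1 : 0 < (2^-1 : R) ^+ k.+1 by rewrite exprn_gt0// invr_gt0.
  have : normc (u k.+2 - u k.+1) <= 2^-1 * normc (u k.+1 - u k).
    by apply: cT; nra.
  by lra.
have [l ul] := complex_geometric_cvg (fun k => (u_inv k).2).
have ud k : normc (u k - y0) <= d / 2.
  have q0 : 0 < (2^-1 : R) ^+ k by rewrite exprn_gt0// invr_gt0.
  by apply: le_trans (u_inv k).1 _; nra.
have ld : normc (l - y0) < d.
  have d20 : 0 < d / 2 by lra.
  have [k uk] := filter_ex (ul _ d20).
  have -> : l - y0 = (u k - y0) - (u k - l) by ring.
  by apply: le_lt_trans (normcB_le _ _) _; have := ud k; lra.
(* The limit is a zero because [H x (u k)] is [b] times [u k - u k.+1], and both this and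
   [H x l - H x (u k)] become arbitrarily small. *)
exists l => //; apply/eqP; rewrite -[_ == _]negbK -normc_gt0 -leNgt.
apply/ler_addgt0Pr => e e0; rewrite add0r.
have C0 : 0 < L + 2 * normc b by lra.
pose e' := e / (L + 2 * normc b); have e'0 : 0 < e' by rewrite divr_gt0.
have eE : e = L * e' + 2 * normc b * e' by rewrite /e'; field; rewrite gt_eqF.
have ulS : \forall k \near \oo, normc (u k.+1 - l) < e'.
  by have [N _ NP] := ul _ e'0; exists N => // k Nk; exact: (NP k.+1 (leqW Nk)).
have [k [uk uk1]] := filter_ex (filterI (ul _ e'0) ulS).
have ukd : normc (u k - y0) < d by have := ud k; lra.
have H1 := lipH _ _ ld ukd; rewrite (normc_distC l) in H1.
have HE : H x l = (H x l - H x (u k)) + b * ((u k - l) - (u k.+1 - l)).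
  by rewrite /u iterS /T -/(u k); field; rewrite -normc_gt0.
rewrite HE; apply: le_trans (normcD_le _ _) _; rewrite normcM.
have H2 := normcB_le (u k - l) (u k.+1 - l).
have := ler_wpM2l (ltW b0) H2.
have := ler_wpM2l (ltW b0) (ltW uk); have := ler_wpM2l (ltW b0) (ltW uk1).
have := ler_wpM2l (ltW L0) (ltW uk); rewrite eE.
by lra.
Unshelve. all: by end_near. Qed.

End NewtonIteration.

(** * Implicit functions and differentiation along curves of zeros *)

Section ImplicitFunction.
Context {R : realType}.
Local Notation K := R[i].
Implicit Types (H : K -> K -> K) (a b c x y : K) (phi : R -> K) (t : R).

(** The Lipschitz bound between any two points near [x0] later gives continuity of [phi] at all
    nearby points, not only at [x0]. *)
Lemma sdiff_implicit H x0 y0 a b : sdiff H x0 y0 a b -> b != 0 ->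
  H x0 y0 = 0 ->
  exists phi : K -> K, phi x0 = y0 /\
    exists C : R, \forall r \near 0^'+, forall x1 x2,
      normc (x1 - x0) < r -> normc (x2 - x0) < r ->
      H x1 (phi x1) = 0 /\ normc (phi x1 - phi x2) <= C * normc (x1 - x2).
Proof.
move=> dH b0 H0.
have [d [d0 [Hlip Hsol]]] := filter_ex (filterI (nbhs_right_gt 0)
  (filterI (sdiff_implicit_lip dH b0) (sdiff_solvable dH b0 H0))).
have [r0 [r00 [r0d r0P]]] := filter_ex (filterI (nbhs_right_gt 0)
  (filterI (nbhs_right_le d0) Hsol)).
(* Outside the ball of radius [r0] the default value is [y0]. *)
have /choice[phi phiP] : forall x, exists y,
    normc (x - x0) < r0 -> normc (y - y0) < d /\ H x y = 0.
  move=> x; have [xr|xr] := boolP (normc (x - x0) < r0); last by exists y0.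
  by have [y yd Hy] := r0P _ xr; exists y.
have x0d r : 0 < r -> normc (x0 - x0) < r.
  by rewrite subrr normc0.
have y0d : normc (y0 - y0) < d by rewrite subrr normc0.
exists phi; split.
  (* [phi x0] and [y0] are both zeros over [x0], so the Lipschitz bound makes their distance 0. *)
  apply/eqP; rewrite -subr_eq0 -[_ == _]negbK -normc_gt0 -leNgt.
  have [pd pH] := phiP _ (x0d _ r00).
  have := Hlip _ _ _ _ (x0d _ d0) pd (x0d _ d0) y0d pH H0.
  by rewrite [x0 - x0]subrr normc0 mulr0.
exists ((2 * normc a + normc b) / normc b); near=> r => x1 x2 x1r x2r.
have rr0 : r <= r0 by near: r; exact: nbhs_right_le.
have [y1d Hy1] := phiP _ (lt_le_trans x1r rr0).
have [y2d Hy2] := phiP _ (lt_le_trans x2r rr0).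
split => //; apply: Hlip => //; apply: lt_le_trans r0d;
  exact: lt_le_trans rr0.
Unshelve. all: by end_near. Qed.

(** The real parameter enters through [%:C], so that the estimate can be substituted into [sdiff];
    [cderivP] translates it to the real and imaginary parts. *)
Definition cderiv phi t c := forall e : R, 0 < e ->
  \forall s \near t, normc (phi s - phi t - c * (s - t)%:C) <= e * `|s - t|.

Lemma cderivP phi t c : cderiv phi t c <->
  is_derive t 1 (fun s => complex.Re (phi s)) (complex.Re c) /\
  is_derive t 1 (fun s => complex.Im (phi s)) (complex.Im c).
Proof.
have ReE (u v w : K) (r : R) : complex.Re (u - v - w * r%:C) =
    complex.Re u - complex.Re v - complex.Re w * r.
  by case: u v w => [? ?] [? ?] [? ?] /=; ring.
have ImE (u v w : K) (r : R) : complex.Im (u - v - w * r%:C) =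
    complex.Im u - complex.Im v - complex.Im w * r.
  by case: u v w => [? ?] [? ?] [? ?] /=; ring.
split=> [dphi|[dRe dIm] e e0].
  split; apply/is_derive1P => e e0; apply: filterS (dphi e e0) => s.
    by rewrite -ReE; exact: le_trans (norm_Re_le _).
  by rewrite -ImE; exact: le_trans (norm_Im_le _).
have e20 : 0 < e / 2 by lra.
near=> s; apply: le_trans (normc_le_ReIm _) _.
rewrite [e]splitr mulrDl ReE ImE lerD//; near: s.
  exact: ((is_derive1P _ _ _).1 dRe).
exact: ((is_derive1P _ _ _).1 dIm).
Unshelve. all: by end_near. Qed.

Lemma near_dist_lt t (d : R) : 0 < d -> \forall s \near t, `|s - t| < d.
Proof.
move=> d0; near=> s; rewrite distrC; near: s.
exact: (@nbhsx_ballx _ _ t (PosNum d0)%:num).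
Unshelve. all: by end_near. Qed.

Lemma cderiv_cont phi t c : cderiv phi t c ->
  forall e : R, 0 < e -> \forall s \near t, normc (phi s - phi t) < e.
Proof.
move=> dphi e e0.
have C0 : 0 < normc c + 1 by rewrite ltr_wpDl// normc_ge0.
near=> s.
have st : `|s - t| < e / (normc c + 1).
  by near: s; apply: near_dist_lt; rewrite divr_gt0.
have H1 : normc (phi s - phi t - c * (s - t)%:C) <= 1 * `|s - t|.
  by near: s; exact: dphi.
rewrite -[X in normc X](subrK (c * (s - t)%:C)).
apply: le_lt_trans (normcD_le _ _) _; rewrite (normcM c) normc_real.
rewrite ltr_pdivlMr// in st; lra.
Unshelve. all: by end_near. Qed.

Lemma real_complex_sub (s t : R) : s%:C - t%:C = (s - t)%:C.
Proof. by rewrite rmorphB. Qed.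

(** Only continuity of the curve is assumed, so this covers every continuous curve of zeros, not
    just the one built by [sdiff_implicit]. The linear part of [H] along the curve is small against
    both increments, and the Lipschitz bound absorbs that of [phi]. *)
Lemma implicit_cderiv H phi t a b : sdiff H t%:C (phi t) a b -> b != 0 ->
  (\forall s \near t, H s%:C (phi s) = 0) ->
  (forall e : R, 0 < e -> \forall s \near t, normc (phi s - phi t) < e) ->
  cderiv phi t (- a / b).
Proof.
move=> dH b0 H0 phic e e0.
have b0' := b0; rewrite -normc_gt0 in b0'.
pose C := (2 * normc a + normc b) / normc b.
have C0 : 0 <= C by rewrite divr_ge0 ?addr_ge0 ?mulr_ge0 ?normc_ge0.
(* After division by [normc b], the error [e' * (1 + C)] is exactly [e]. *)
pose e' := e * normc b / (1 + C).
have e'0 : 0 < e' by rewrite divr_gt0 ?mulr_gt0 ?ltr_wpDr.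
have [d [d0 [Hlip Hd]]] := filter_ex (filterI (nbhs_right_gt 0)
  (filterI (sdiff_implicit_lip dH b0) (dH _ e'0))).
near=> s.
have st : normc (s%:C - t%:C) < d.
  by rewrite real_complex_sub normc_real; near: s; exact: near_dist_lt.
have pst : normc (phi s - phi t) < d by near: s; exact: phic.
have tt : normc (t%:C - t%:C) < d by rewrite subrr normc0.
have pp : normc (phi t - phi t) < d by rewrite subrr normc0.
have Hs : H s%:C (phi s) = 0 by near: s.
have Ht : H t%:C (phi t) = 0 by exact: nbhs_singleton H0.
have := Hd _ _ _ _ st pst tt pp; rewrite Hs Ht subrr sub0r normc_opp.
have := Hlip _ _ _ _ st pst tt pp Hs Ht.
rewrite real_complex_sub normc_real -/C => L1 L2.
have -> : phi s - phi t - - a / b * (s - t)%:C =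
  (a * (s - t)%:C + b * (phi s - phi t)) / b by field.
rewrite normcM normcV ler_pdivrMr//.
apply: le_trans L2 _.
have -> : e * `|s - t| * normc b = e' * (`|s - t| + C * `|s - t|).
  by rewrite /e'; field; rewrite gt_eqF// ltr_wpDr.
by rewrite ler_pM2l// lerD2l.
Unshelve. all: by end_near. Qed.

(** The chain rule for a vanishing composite. Unlike in [implicit_cderiv], [b] may be 0, which is
    what later rules out differentiable branches through a multiple root. *)
Lemma sdiff_curve_zero H phi t a b c : sdiff H t%:C (phi t) a b ->
  cderiv phi t c -> (\forall s \near t, H s%:C (phi s) = 0) ->
  a + b * c = 0.
Proof.
move=> dH dphi H0; apply/eqP; rewrite -[_ == _]negbK -normc_gt0 -leNgt.
(* In units of the distance from [s] to [t], the two increments in the strict estimate cost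
   [1 + (1 + normc c)], and the remainder of the curve costs [normc b]. *)
pose C := 2 + normc c + normc b.
have C0 : 0 < C by rewrite ltr_wpDr ?normc_ge0// ltr_wpDr ?normc_ge0.
apply/ler_addgt0Pr => e e0; rewrite add0r.
pose e' := Num.min 1 (e / C).
have e'0 : 0 < e' by rewrite lt_min ltr01 divr_gt0.
have e'1 : e' <= 1 by rewrite ge_min lexx.
have e'e : e' * C <= e by rewrite -ler_pdivlMr// ge_min lexx orbT.
have [d [d0 Hd]] := filter_ex (filterI (nbhs_right_gt 0) (dH _ e'0)).
apply: le_trans e'e.
suff [s [st hs]] : exists s, s != t /\ normc (a + b * c) * `|s - t| <=
    e' * C * `|s - t|.
  by rewrite -(@ler_pM2r _ `|s - t|)// normr_gt0 subr_eq0.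
apply: (@filter_ex _ t^'); near=> s; split.
  by near: s; exact: nbhs_dnbhs_neq.
have st : normc (s%:C - t%:C) < d.
  rewrite real_complex_sub normc_real; near: s; apply: nbhs_dnbhs.
  exact: near_dist_lt.
have pst : normc (phi s - phi t) < d.
  by near: s; apply: nbhs_dnbhs; exact: (cderiv_cont dphi).
have tt : normc (t%:C - t%:C) < d by rewrite subrr normc0.
have pp : normc (phi t - phi t) < d by rewrite subrr normc0.
have Hs : H s%:C (phi s) = 0 by near: s; exact: nbhs_dnbhs.
have Ht : H t%:C (phi t) = 0 by exact: nbhs_singleton H0.
have := Hd _ _ _ _ st pst tt pp; rewrite Hs Ht subrr sub0r normc_opp.
rewrite real_complex_sub normc_real.
have D : normc (phi s - phi t - c * (s - t)%:C) <= e' * `|s - t|.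
  by near: s; apply: nbhs_dnbhs; exact: dphi.
have D2 : normc (phi s - phi t) <= (1 + normc c) * `|s - t|.
  rewrite -[X in normc X](subrK (c * (s - t)%:C)).
  apply: le_trans (normcD_le _ _) _; rewrite (normcM c) normc_real.
  by have := ler_wpM2r (normr_ge0 (s - t)) e'1; lra.
move=> D1.
rewrite -normc_real -normcM.
have -> : (a + b * c) * (s - t)%:C = (a * (s - t)%:C + b * (phi s - phi t))
   - b * (phi s - phi t - c * (s - t)%:C) by ring.
apply: le_trans (normcB_le _ _) _; rewrite (normcM b) normc_real.
have := ler_wpM2l (normc_ge0 b) D; have := ler_wpM2l (ltW e'0) D2.
by rewrite /C; lra.
Unshelve. all: by end_near. Qed.

(** Locally this function is minus the real part of a complex logarithm; the route through the
    squared modulus avoids choosing a branch. *)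
Lemma is_derive_neg_ln_normc phi t c : phi t != 0 -> cderiv phi t c ->
  is_derive t 1 (fun s => - ln (normc (phi s))) (- complex.Re (c / phi t)).
Proof.
move=> phi0 /cderivP[dRe dIm].
pose p s := complex.Re (phi s); pose q s := complex.Im (phi s).
have N0 : 0 < p t ^+ 2 + q t ^+ 2.
  rewrite -normc_gt0 in phi0; move: phi0; rewrite /p /q.
  case: (phi t) => u v /=.
  by rewrite sqrtr_gt0.
have S0 : 0 < Num.sqrt (p t ^+ 2 + q t ^+ 2) by rewrite sqrtr_gt0.
have -> : (fun s => - ln (normc (phi s))) =
    - (@ln R \o (Num.sqrt \o (p ^+ 2 + q ^+ 2))).
  apply/funext => s; rewrite /= /p /q !fctE /=; congr (- ln _).
  by case: (phi s).
have dN : is_derive t 1 (p ^+ 2 + q ^+ 2)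
    (2 * p t * complex.Re c + 2 * q t * complex.Im c).
  have dp : is_derive t 1 p (complex.Re c) by [].
  have dq : is_derive t 1 q (complex.Im c) by [].
  apply: is_derive_eq; rewrite /GRing.scale /=; ring.
have dS := @is_derive1_comp _ Num.sqrt (p ^+ 2 + q ^+ 2) _ _ _
  (is_derive1_sqrt N0) dN.
have dL := @is_derive1_comp _ (@ln R) (Num.sqrt \o (p ^+ 2 + q ^+ 2)) _ _ _
  (is_derive1_ln S0) dS.
apply: is_derive_eq (is_deriveN dL) _.
congr (- _); rewrite mulrA -invfM.
have -> : Num.sqrt (p t ^+ 2 + q t ^+ 2) *
    (2 * Num.sqrt (p t ^+ 2 + q t ^+ 2)) =
  2 * (p t ^+ 2 + q t ^+ 2) by rewrite mulrCA -expr2 sqr_sqrtr// ltW.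
have -> : complex.Re (c / phi t) =
    (complex.Re c * p t + complex.Im c * q t) / (p t ^+ 2 + q t ^+ 2).
  move: N0; rewrite /p /q; case: (phi t) => u v /= N0.
  case: c {dRe dIm dN dS dL} => z w /=.
  by field; rewrite gt_eqF.
by field; rewrite gt_eqF.
Qed.

End ImplicitFunction.

(** * Derivatives in the second variable and the transversality identity *)

Section CharacteristicFunction.
Context {R : realType}.
Local Notation K := R[i].
Implicit Types (H : K -> K -> K) (a b c x y : K) (phi : R -> K) (t : R).

Lemma near_normc_lt t (d : R) : 0 < d ->
  \forall s \near t, normc (s%:C - t%:C) < d.
Proof.
move=> d0; near=> s; rewrite real_complex_sub normc_real.
by near: s; exact: near_dist_lt.
Unshelve. all: by end_near. Qed.

Lemma sdiff_derive1 H x y a b : sdiff H x y a b ->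
  derive1 (H x : R[i]^o -> R[i]^o) y = b.
Proof.
move=> dH; apply: cvg_lim => //; apply/cvgrPdist_le => e e0.
(* A positive element of [R[i]] has zero imaginary part. *)
have [e1 e10 ->] : exists2 e1 : R, 0 < e1 & e = e1%:C.
  case: e e0 => u v; rewrite ltcE /= => /andP[/eqP -> u0]; by exists u.
have [d [d0 Hd]] := filter_ex (filterI (nbhs_right_gt 0) (dH _ e10)).
rewrite near_withinE; near=> h => h0.
have hd : normc h < d.
  rewrite -ltcR -norm_normc; near: h; apply: (@nbhs0_lt _ R[i]^o).
  by rewrite ltcR.
have xx : normc (x - x) < d by rewrite subrr normc0.
have yy : normc (y - y) < d by rewrite subrr normc0.
have hy : normc (h + y - y) < d by rewrite addrK.
have := Hd _ _ _ _ xx hy xx yy.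
rewrite subrr normc0 mulr0 !add0r addrK => Hh.
rewrite norm_normc lecR normc_distC.
have -> : h^-1 *: (H x (h + y) - H x y : R[i]^o) - b =
    (H x (h + y) - H x y - b * h) / h by rewrite /GRing.scale /=; field.
rewrite normcM normcV ler_pdivrMr// normc_gt0.
exact: h0.
Unshelve. all: by end_near. Qed.

(** A single displacement by the real number [d / 2] already compares the two linear approximations.
    The uses take [e] to be half a modulus, for nonvanishing nearby, and 0, for exact uniqueness. *)
Lemma sdiff_snd_unique H x y a b c (e : R) : sdiff H x y a b ->
  (\forall d \near 0^'+, forall y1, normc (y1 - y) < d ->
     normc (H x y1 - H x y - c * (y1 - y)) <= e * normc (y1 - y)) ->
  normc (b - c) <= e.
Proof.
move=> dH cH; apply/ler_addgt0Pr => e' e'0.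
have [d [d0 [Hd Hc]]] := filter_ex (filterI (nbhs_right_gt 0)
  (filterI (dH _ e'0) cH)).
have d20 : 0 < d / 2 by lra.
pose y1 := y + (d / 2)%:C.
have y1E : y1 - y = (d / 2)%:C by rewrite /y1 addrAC subrr add0r.
have n1 : normc (y1 - y) = d / 2 by rewrite y1E normc_real gtr0_norm.
have y1d : normc (y1 - y) < d by rewrite n1; lra.
have xx : normc (x - x) < d by rewrite subrr normc0.
have yy : normc (y - y) < d by rewrite subrr normc0.
have := Hd _ _ _ _ xx y1d xx yy; have := Hc _ y1d.
rewrite subrr normc0 mulr0 !add0r n1 => h1 h2.
rewrite -(ler_pM2r d20) -[in leLHS]n1 -normcM.
have -> : (b - c) * (y1 - y) = (H x y1 - H x y - c * (y1 - y)) -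
  (H x y1 - H x y - b * (y1 - y)) by ring.
by apply: le_trans (normcB_le _ _) _; lra.
Qed.

(** The strict estimate at [(x, y)] is also an approximate one at each nearby base point, so [b1]
    lies within [normc b / 2] of [b]. This stands in for continuity of the partial derivative. *)
Lemma sdiff_neq0_near H x y a b : sdiff H x y a b -> b != 0 ->
  \forall d \near 0^'+, forall x1 y1 a1 b1,
    normc (x1 - x) < d -> normc (y1 - y) < d -> sdiff H x1 y1 a1 b1 -> b1 != 0.
Proof.
move=> dH; rewrite -normc_gt0 => b0.
have b20 : 0 < normc b / 2 by lra.
apply: filterS (dH _ b20) => d Hd x1 y1 a1 b1 x1d y1d dH1.
suff : normc (b1 - b) <= normc b / 2.
  by apply: contraTneq => ->; rewrite sub0r normc_opp -ltNge; lra.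
apply: (sdiff_snd_unique dH1); near=> d1 => y2 y2d1.
have y2d : normc (y2 - y) < d.
  have -> : y2 - y = (y2 - y1) + (y1 - y) by ring.
  apply: le_lt_trans (normcD_le _ _) _.
  suff : d1 <= d - normc (y1 - y) by lra.
  by near: d1; apply: nbhs_right_le; rewrite subr_gt0.
have := Hd _ _ _ _ x1d y2d x1d y1d.
by rewrite subrr normc0 mulr0 !add0r.
Unshelve. all: by end_near. Qed.

Lemma continuous_normcP phi t : {for t, continuous (phi : R -> R[i]^o)} <->
  forall e : R, 0 < e -> \forall s \near t, normc (phi s - phi t) < e.
Proof.
split=> [/cvgrPdist_lt phic e e0|phic].
  have e0' : 0 < e%:C :> R[i] by rewrite ltcR.
  apply: filterS (phic _ e0') => s.
  by rewrite norm_normc ltcR normc_distC.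
apply/cvgrPdist_lt => e e0.
have [e1 e10 ->] : exists2 e1 : R, 0 < e1 & e = e1%:C.
  case: e e0 => u v; rewrite ltcE /= => /andP[/eqP -> u0]; by exists u.
by apply: filterS (phic _ e10) => s; rewrite norm_normc ltcR normc_distC.
Qed.

Lemma Re_div (u v : K) : v != 0 -> complex.Re (u / v) * normc v ^+ 2 =
  complex.Re u * complex.Re v + complex.Im u * complex.Im v.
Proof.
case: u v => [p q] [z w]; rewrite -normc_gt0 /= sqrtr_gt0 => v0.
by rewrite sqr_sqrtr ?ltW//; field; rewrite gt_eqF.
Qed.

(** After multiplying by the conjugate denominator, the delay contributes the real part of an
    imaginary multiple of [normc P ^+ 2], which is 0. What remains is [w] times the real part of
    ['i * P] times the conjugate of [f], the opposite of the same expression with [f] and [P]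
    exchanged. *)
Lemma transversality_identity (f P : K) (w tau : R) :
  P != 0 -> f - P * tau%:C != 0 ->
  complex.Re ((0 +i* w) * P / (f - P * tau%:C)) * normc (f - P * tau%:C) ^+ 2 =
  - (w * (complex.Re ('i * f / P) * normc P ^+ 2)).
Proof.
move=> P0 D0; rewrite !Re_div//.
by case: f P {P0 D0} => [p q] [u v] /=; ring.
Qed.

(** * Curves of characteristic roots and branches of the asymptotic continuous spectrum *)

Section Characteristic.
Context {n : nat} (A B : 'M[R]_n).

(** Decoupling the exponential gives one function behind both spectra: [char_fun] puts [y] equal to
    the exponential of [- x * tau], and [gen_poly] puts [x] on the imaginary axis. *)
Definition char_det (x y : K) : K := \det (x%:M - mxC A - y *: mxC B).

Lemma horner_gen_poly w y : (gen_poly A B w).[y] = char_det (0 +i* w) y.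
Proof.
rewrite /gen_poly -[LHS]/(horner_eval y _) -det_map_mx; congr (\det _).
by apply/matrixP => i j; rewrite !mxE /= /horner_eval !hornerE.
Qed.

(** The delay is made complex so that roots are implicit functions in the two-variable setting; the
    second partial derivative is the one that simplicity of the root makes nonzero. *)
Lemma sdiff_char_fun t z fz fy : sdiff char_det z (cexp (- (z * t%:C))) fz fy ->
  sdiff (fun s z => char_det z (cexp (- (z * s)))) t%:C z
    (- (fy * cexp (- (z * t%:C)) * z)) (fz - fy * cexp (- (z * t%:C)) * t%:C).
Proof.
move=> dF; set Y := cexp _ in dF *.
have dm := sdiff_comp (sdiff_mul _ _) (sdiff_cst (-1) t%:C z)
  (sdiff_comp (sdiff_mul _ _) (sdiff_snd t%:C z) (sdiff_fst t%:C z)).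
have dc := sdiff_comp (sdiff_cexp _ 0) dm (sdiff_cst 0 t%:C z).
have EH : (fun s z => cexp (-1 * (z * s))) = (fun s z : K => cexp (- (z * s))).
  by apply/funext => u; apply/funext => v; rewrite mulN1r.
rewrite EH mulN1r -/Y in dc.
have dH := @sdiff_comp R char_det (fun _ z => z) (fun s z => cexp (- (z * s)))
  _ _ _ _ _ _ _ _ dF (sdiff_snd t%:C z) dc.
by apply: (sdiff_eq dH); ring.
Qed.

Lemma sdiff_char_det_im (w : R) y fz fy : sdiff char_det ('i * w%:C) y fz fy ->
  sdiff (fun s y => char_det ('i * s) y) w%:C y (fz * 'i) fy.
Proof.
move=> dF.
have di := sdiff_comp (sdiff_mul _ _) (sdiff_cst 'i w%:C y) (sdiff_fst w%:C y).
have := @sdiff_comp R char_det (fun s _ => 'i * s) (fun _ y => y)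
  _ _ _ _ _ _ _ _ dF di (sdiff_snd w%:C y).
by move=> H1; apply: (sdiff_eq H1); ring.
Qed.

Lemma iw_E (w : R) : 0 +i* w = 'i * w%:C.
Proof.
by apply/eqP; rewrite eq_complex /=; apply/andP; split; apply/eqP; ring.
Qed.

Lemma root_family_cderiv t z fz fy lam :
  sdiff char_det z (cexp (- (z * t%:C))) fz fy ->
  fz - fy * cexp (- (z * t%:C)) * t%:C != 0 ->
  root_family A B t z lam ->
  cderiv lam t (fy * cexp (- (z * t%:C)) * z /
                (fz - fy * cexp (- (z * t%:C)) * t%:C)).
Proof.
move=> dF D0 [lamt lamP]; rewrite -[X in X / _]opprK.
have dH := sdiff_char_fun dF; rewrite -lamt in dH D0 *.
apply: implicit_cderiv dH D0 _ _.
  by apply: filterS lamP => s [].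
by apply/continuous_normcP; exact: (nbhs_singleton lamP).2.
Qed.

(** The family is the implicit function restricted to real delays; its Lipschitz bound gives
    continuity at every nearby delay, as [root_family] demands. *)
Lemma root_family_exists t z fz fy :
  sdiff char_det z (cexp (- (z * t%:C))) fz fy ->
  fz - fy * cexp (- (z * t%:C)) * t%:C != 0 ->
  char_fun A B t z = 0 ->
  exists lam, root_family A B t z lam.
Proof.
move=> dF D0 H0; have dH := sdiff_char_fun dF.
have [phi [phit [C phiP]]] := sdiff_implicit dH D0 H0.
have [r [r0 phir]] := filter_ex (filterI (nbhs_right_gt 0) phiP).
exists (fun s => phi s%:C); split => //.
near=> s.
have sr : `|s - t| < r by near: s; exact: near_dist_lt.
have sr' : normc (s%:C - t%:C) < r by rewrite real_complex_sub normc_real.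
split; first exact: (phir _ _ sr' sr').1.
apply/continuous_normcP => e e0.
have C0 : 0 < `|C| + 1 by rewrite ltr_wpDl.
near=> u.
have us : `|u - s| < e / (`|C| + 1).
  by near: u; apply: near_dist_lt; rewrite divr_gt0.
have ur : normc (u%:C - t%:C) < r.
  rewrite real_complex_sub normc_real.
  have -> : u - t = (u - s) + (s - t) by ring.
  apply: le_lt_trans (ler_normD _ _) _; rewrite -ltrBrDr.
  by near: u; apply: near_dist_lt; rewrite subr_gt0.
apply: le_lt_trans (phir _ _ ur sr').2 _.
rewrite real_complex_sub normc_real.
rewrite ltr_pdivlMr// in us.
have := ler_wpM2r (normr_ge0 (u - s)) (ler_norm C).
have := normr_ge0 (u - s); lra.
Unshelve. all: by end_near. Qed.

Lemma acs_branch_is_derive (w : R) y fz fy gamma :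
  sdiff char_det (0 +i* w) y fz fy -> y != 0 -> (fz != 0) || (fy != 0) ->
  acs_branch A B w y gamma ->
  fy != 0 /\ is_derive w 1 gamma (complex.Re ('i * fz / (fy * y))).
Proof.
move=> dF y0 f0 [Y Yw YP].
have [_ _ dRe dIm _] := nbhs_singleton YP.
have dY : cderiv Y w ('D_1 (fun s => complex.Re (Y s)) w +i*
    'D_1 (fun s => complex.Im (Y s)) w).
  by apply/cderivP; split; exact: derivableP.
set c := _ +i* _ in dY.
rewrite iw_E in dF; have dH := sdiff_char_det_im dF.
have E : fz * 'i + fy * c = 0.
  rewrite -Yw in dH; apply: sdiff_curve_zero dH dY _.
  apply: filterS YP => s [_ + _ _ _].
  by rewrite rootE horner_gen_poly iw_E => /eqP.
have i0 : 'i != 0 :> K by rewrite eq_complex /= oner_eq0 andbF.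
(* If [fy] were 0, the relation [E] would force [fz] to be 0 as well, against [f0]. *)
have fy0 : fy != 0.
  apply: contraTneq f0 => fy0; rewrite fy0 eqxx orbF.
  move: E; rewrite fy0 mul0r addr0 => /eqP; rewrite mulf_eq0 (negbTE i0) orbF.
  by move=> /eqP ->; rewrite eqxx.
split; first exact: fy0.
have cE : c = - ('i * fz) / fy.
  apply: (mulfI fy0); rewrite mulrCA divff// mulr1.
  by apply/eqP; rewrite -subr_eq0 opprK addrC [_ * fz]mulrC; apply/eqP.
have dg : is_derive w 1 (fun s => - ln (normc (Y s))) (- complex.Re (c / Y w)).
  by apply: is_derive_neg_ln_normc => //; rewrite Yw.
have -> : complex.Re ('i * fz / (fy * y)) = - complex.Re (c / Y w).
  rewrite -raddfN; congr complex.Re; rewrite Yw cE; field.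
  by rewrite fy0 y0.
by apply: near_eq_is_derive dg; apply: filterS YP => s [].
Qed.

(** A branch must be differentiable at all nearby frequencies, so the implicit derivative is taken
    afresh at each of them, its denominator being nonzero by [sdiff_neq0_near]. *)
Lemma acs_branch_exists (w : R) y fz fy :
  sdiff char_det (0 +i* w) y fz fy -> fy != 0 -> char_det (0 +i* w) y = 0 ->
  exists2 gamma, acs_branch A B w y gamma & gamma w = - ln (normc y).
Proof.
rewrite iw_E => dF fy0 F0; have dH := sdiff_char_det_im dF.
have [phi [phiw [C phiP]]] := sdiff_implicit dH fy0 F0.
have [d [d0 dP]] := filter_ex (filterI (nbhs_right_gt 0)
  (sdiff_neq0_near dH fy0)).
have [r [r0 phir]] := filter_ex (filterI (nbhs_right_gt 0) phiP).
have C0 : 0 < `|C| + 1 by rewrite ltr_wpDl.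
exists (fun s => - ln (normc (phi s%:C))); last by rewrite phiw.
exists (fun s => phi s%:C) => //.
have rw : normc (w%:C - w%:C) < r by rewrite subrr normc0.
have lip s u : normc (s%:C - w%:C) < r -> normc (u%:C - w%:C) < r ->
    normc (phi s%:C - phi u%:C) <= (`|C| + 1) * `|s - u|.
  move=> sr ur; apply: le_trans (phir _ _ sr ur).2 _.
  rewrite real_complex_sub normc_real ler_wpM2r//.
  by apply: le_trans (ler_norm C) _; rewrite lerDl.
near=> s.
have sr : normc (s%:C - w%:C) < r by near: s; exact: near_normc_lt.
have sd : normc (s%:C - w%:C) < d by near: s; exact: near_normc_lt.
have psd : normc (phi s%:C - y) < d.
  rewrite -phiw; apply: le_lt_trans (lip _ _ sr rw) _.
  rewrite -ltr_pdivlMl//; near: s; apply: near_dist_lt.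
  by rewrite mulr_gt0 ?invr_gt0.
have [a' [b' dF']] := sdiffable_det (mxC A) (mxC B) ('i * s%:C) (phi s%:C).
have dH' := sdiff_char_det_im dF'.
have b'0 := dP _ _ _ _ sd psd dH'.
have nearH : \forall u \near s, char_det ('i * u%:C) (phi u%:C) = 0.
  near=> u; have ur : normc (u%:C - w%:C) < r.
    have -> : u%:C - w%:C = (u%:C - s%:C) + (s%:C - w%:C) by ring.
    apply: le_lt_trans (normcD_le _ _) _; rewrite -ltrBrDr.
    by near: u; apply: near_normc_lt; rewrite subr_gt0.
  exact: (phir _ _ ur ur).1.
have phic (e : R) : 0 < e -> \forall u \near s, normc (phi u%:C - phi s%:C) < e.
  move=> e0; near=> u.
  have ur : normc (u%:C - w%:C) < r.
    have -> : u%:C - w%:C = (u%:C - s%:C) + (s%:C - w%:C) by ring.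
    apply: le_lt_trans (normcD_le _ _) _; rewrite -ltrBrDr.
    by near: u; apply: near_normc_lt; rewrite subr_gt0.
  apply: le_lt_trans (lip _ _ ur sr) _.
  rewrite -ltr_pdivlMl//; near: u; apply: near_dist_lt.
  by rewrite mulr_gt0 ?invr_gt0.
have /cderivP[[dRe _] [dIm _]] :=
  @implicit_cderiv R _ (fun u => phi u%:C) s _ _ dH' b'0 nearH phic.
split => //.
(* A degenerate polynomial makes [char_det] constant in its second argument, so its derivative [b']
   would be 0. *)
- rewrite /degenerate => deg.
  have Fc u v : char_det ('i * s%:C) u = char_det ('i * s%:C) v.
    by rewrite -iw_E -!horner_gen_poly deg !hornerC.
  have : normc (b' - 0) <= 0.
    apply: (sdiff_snd_unique dH'); apply: nearW => d1 y1 _.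
    by rewrite mul0r (Fc y1 (phi s%:C)) subrr subr0 mul0r normc0.
  by rewrite subr0 leNgt normc_gt0 b'0.
- by rewrite rootE horner_gen_poly iw_E; apply/eqP; exact: nbhs_singleton nearH.
Unshelve. all: by end_near. Qed.

End Characteristic.
End CharacteristicFunction.

(** * Crossing speed of the root against slope of the branch *)

Section CrossingSpeed.
Context {R : realType} {n : nat} (A B : 'M[R]_n).

(** The speed [l] is common to all root families and the slope [g] to all branches through the given
    point, so the theorem reduces to comparing two signs. A nonzero [l] forces [fy] to be nonzero,
    which supplies a branch. *)
Lemma crossing_speed (omegaH tauH : R) (lambdac : R[i]) :
  0 < omegaH -> lambdac = 0 +i* omegaH ->
  simple_char_root A B tauH lambdac ->
  exists l g : R,
  [/\ exists lam, root_family A B tauH lambdac lam,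
      forall lam, root_family A B tauH lambdac lam ->
        is_derive tauH 1 (fun t => complex.Re (lam t)) l,
      forall gamma,
        acs_branch A B omegaH (cexp (- (lambdac * tauH%:C))) gamma ->
        is_derive omegaH 1 gamma g /\ Num.sg l = - Num.sg g &
      l != 0 -> exists2 gamma,
        acs_branch A B omegaH (cexp (- (lambdac * tauH%:C))) gamma &
        gamma omegaH = 0].
Proof.
move=> w0 lE [root0]; set Y0 := cexp _.
have [fz [fy dF]] := sdiffable_det (mxC A) (mxC B) lambdac Y0.
have dH := sdiff_char_fun dF; rewrite -/Y0 in dH.
have -> : derive1 (char_fun A B tauH : R[i]^o -> R[i]^o) lambdac =
  fz - fy * Y0 * tauH%:C by exact: sdiff_derive1 dH.
move=> D0.
(* [lambdac] is purely imaginary, so [Y0] lies on the unit circle; hence branches through [Y0]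
   vanish at [omegaH]. *)
have nY0 : normc Y0 = 1.
  by rewrite normc_cexp lE /= mul0r mulr0 subrr oppr0 expR0.
have Y00 : Y0 != 0 by rewrite -normc_gt0 nY0.
have f0 : (fz != 0) || (fy != 0).
  apply: contraNT D0; rewrite negb_or !negbK => /andP[/eqP-> /eqP->].
  by rewrite !mul0r subrr.
exists (complex.Re (fy * Y0 * lambdac / (fz - fy * Y0 * tauH%:C))),
  (complex.Re ('i * fz / (fy * Y0))).
split.
- exact: root_family_exists dF D0 root0.
- by move=> lam /(root_family_cderiv dF D0)/cderivP[].
- have dF' := dF; rewrite lE in dF'.
  move=> gamma /(acs_branch_is_derive dF' Y00 f0)[fy0 dg].
  split=> //; have P0 : fy * Y0 != 0 by rewrite mulf_neq0.
  have := transversality_identity omegaH P0 D0.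
  rewrite -lE [lambdac * _]mulrC; move: (complex.Re _) (complex.Re _) => l g lg.
  rewrite -normc_gt0 in P0; rewrite -normc_gt0 in D0.
  move: lg (exprn_gt0 2 P0) (exprn_gt0 2 D0).
  (* The squared moduli and [omegaH] are positive, so the identity becomes a relation between
     signs. *)
  move: (_ ^+ 2) (_ ^+ 2) => u v /(congr1 Num.sg) + v0 u0.
  by rewrite sgrN !sgrM (gtr0_sg w0) (gtr0_sg u0) (gtr0_sg v0) !mulr1 mul1r.
- move=> l0; have fy0 : fy != 0.
    by apply: contraNneq l0 => ->; rewrite !mul0r.
  have dF' := dF; rewrite lE in dF'.
  have root0' : char_det A B (0 +i* omegaH) Y0 = 0 by rewrite -lE.
  have [gamma hg gE] := acs_branch_exists dF' fy0 root0'.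
  by exists gamma => //; rewrite gE nY0 ln1 oppr0.
Qed.

End CrossingSpeed.

(** * Equivalence and direction of the crossing *)

Theorem theorem3p1 (R : realType) (n : nat) (A B : 'M[R]_n)
    (omegaH tauH : R) (lambdac : R[i])
    (omegaH_gt0 : 0 < omegaH) (tauH_gt0 : 0 < tauH)
    (lambdacE : lambdac = 0 +i* omegaH)
    (lambdac_simple : simple_char_root A B tauH lambdac) :
  [/\ transverse_crossing A B tauH lambdac <->
        (exists gamma : R -> R,
          [/\ acs_branch A B omegaH (cexp (- (lambdac * tauH%:C))) gamma,
              gamma omegaH = 0,
              derivable gamma omegaH 1
            & derive1 gamma omegaH != 0]),
      forall gamma : R -> R,
        acs_branch A B omegaH (cexp (- (lambdac * tauH%:C))) gamma ->
        gamma omegaH = 0 -> derivable gamma omegaH 1 ->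
        derive1 gamma omegaH < 0 ->
        destabilizing_crossing A B tauH lambdac /\
        forall lam : R -> R[i], root_family A B tauH lambdac lam ->
          derivable (fun t => complex.Re (lam t)) tauH 1 /\
          0 < derive1 (fun t => complex.Re (lam t)) tauH
    & forall gamma : R -> R,
        acs_branch A B omegaH (cexp (- (lambdac * tauH%:C))) gamma ->
        gamma omegaH = 0 -> derivable gamma omegaH 1 ->
        0 < derive1 gamma omegaH ->
        stabilizing_crossing A B tauH lambdac /\
        forall lam : R -> R[i], root_family A B tauH lambdac lam ->
          derivable (fun t => complex.Re (lam t)) tauH 1 /\
          derive1 (fun t => complex.Re (lam t)) tauH < 0].
Proof.
have [l [g [[lam0 famlam0] lamP gammaP gamma_ex]]] :=
  crossing_speed omegaH_gt0 lambdacE lambdac_simple.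
have lamE lam : root_family A B tauH lambdac lam ->
    derivable (fun t => complex.Re (lam t)) tauH 1 /\
    derive1 (fun t => complex.Re (lam t)) tauH = l.
  by move=> /lamP[dlam lE]; rewrite derive1E.
have gammaE gamma :
    acs_branch A B omegaH (cexp (- (lambdac * tauH%:C))) gamma ->
    [/\ derivable gamma omegaH 1, derive1 gamma omegaH = g &
        Num.sg l = - Num.sg g].
  by move=> /gammaP[[dg gE] lg]; rewrite derive1E.
have Re0 lam : root_family A B tauH lambdac lam -> complex.Re (lam tauH) = 0.
  by move=> [-> _]; rewrite lambdacE.
split.
- split=> [[lam [fam _ dlam]]|[gamma [hg _ dg]]].
    have [_ ->] := lamE _ fam => l0.
    have [gamma hg gamma0] := gamma_ex l0; have [dg gE lg] := gammaE _ hg.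
    exists gamma; split=> //; rewrite gE -sgr_eq0 -oppr_eq0 -lg sgr_eq0.
    exact: l0.
  have [_ -> lg] := gammaE _ hg => g0.
  have [dl lE] := lamE _ famlam0.
  exists lam0; split=> //; first exact: Re0.
  by rewrite lE -sgr_eq0 lg oppr_eq0 sgr_eq0.
- move=> gamma hg _ _; have [_ -> lg] := gammaE _ hg => g0.
  have l0 : 0 < l by rewrite -sgr_gt0 lg oppr_gt0 sgr_lt0.
  split; last by move=> lam /lamE[dl ->].
  have [dl lE] := lamE _ famlam0.
  by exists lam0; split=> //; rewrite ?lE//; exact: Re0.
- move=> gamma hg _ _; have [_ -> lg] := gammaE _ hg => g0.
  have l0 : l < 0 by rewrite -sgr_lt0 lg oppr_lt0 sgr_gt0.
  split; last by move=> lam /lamE[dl ->].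
  have [dl lE] := lamE _ famlam0.
  by exists lam0; split=> //; rewrite ?lE//; exact: Re0.
Qed.
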